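(* Let $p$ be an odd prime, $r=\frac{p-1}{2}$, let $d\mid r$ be a positive divisor, and suppose $D=\frac rd$ is odd. Let $\zeta$ be a primitive $2r$-th root of unity in $\mathbb{F}_p^\times$. For $\epsilon\in\{\pm1\}^r$ let $f_\epsilon\in\mathbb{F}_p[x]$ be the unique polynomial of degree $<r$ with $f_\epsilon(\zeta^{2n})=\epsilon_n\zeta^n$ for $0\le n<r$. If $\epsilon$ has alternating order $a(\epsilon)=d$, then $$\deg(f_\epsilon)=r-\frac{D-1}{2}-nD\quad\text{for some integer }n\ge 0.$$
   Context: The flip shift is the map $\sigma:\{\pm1\}^r\to\{\pm1\}^r$, $\sigma(\epsilon_0,\dots,\epsilon_{r-1})=(\epsilon_1,\dots,\epsilon_{r-1},-\epsilon_0)$; the orbit of $\epsilon$ is $\mathcal{O}_\epsilon=\{\sigma^n(\epsilon):n\in\mathbb{Z}\}$, and the alternating order of $\epsilon$ is $a(\epsilon)=|\mathcal{O}_\epsilon|/2$. The polynomials $f_\epsilon$ are exactly the polynomials $f$ of degree $<r$ with $f(a)^2=a$ for all nonzero squares $a\in\mathbb{F}_p$. *)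

(* Defs.v *)
From mathcomp Require Import all_boot all_order all_fingroup all_algebra.

Set Implicit Arguments.
Unset Strict Implicit.
Unset Printing Implicit Defensive.

Import GRing.Theory.
Local Open Scope ring_scope.

(* An element of {+1,-1}^r is encoded by sign bits: the bit [e i] stands for
   the sign [(-1) ^+ e i], so [false] is +1, [true] is -1 and [~~] is negation. *)
Notation signs r := {ffun 'I_r -> bool}.

(* [ordS i] is [i + 1] modulo [r], so only the last coordinate, the one with
   [i.+1 = r], wraps around and gets [- e 0]. *)
Definition flip_shift_fun (r : nat) (e : signs r) : signs r :=
  [ffun i : 'I_r => if i.+1 == r then ~~ e (ordS i) else e (ordS i)].

Lemma flip_shift_inj (r : nat) : injective (@flip_shift_fun r).
Proof.
move=> e1 e2 /ffunP eq12; apply/ffunP => i.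
have := eq12 (ord_pred i); rewrite !ffunE ord_predK.
by case: ifP => // _ /negb_inj.
Qed.

Definition flip_shift (r : nat) : {perm signs r} := perm (@flip_shift_inj r).

(* [porbit s e] is the orbit of [e] under the cyclic group generated by [s],
   that is, under all integer powers of [s]. *)
Definition alternating_order (r : nat) (e : signs r) : nat :=
  (#|porbit (flip_shift r) e| %/ 2)%N.

Lemma flip_shift_iter (r : nat) (e : signs r) (k : nat) (i j : 'I_r) :
  j = (i + k)%N :> nat -> (flip_shift r ^+ k)%g e i = e j.
Proof.
elim: k i j => [|k IHk] i j.
  by rewrite addn0 => /val_inj->; rewrite expg0 perm1.
move=> def_j; have lt_ir : (i.+1 < r)%N.
  by apply: leq_trans (ltn_ord j); rewrite def_j addnS !ltnS leq_addr.
rewrite expgSr permM permE ffunE ltn_eqF //; apply: IHk.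
by rewrite def_j /= modn_small // addSnnS.
Qed.

Lemma flip_shift_iter_r (r : nat) (e : signs r) (i : 'I_r) :
  (flip_shift r ^+ r)%g e i = ~~ e i.
Proof.
suff H m (k j : 'I_r) : (j + m)%N = r ->
    (flip_shift r ^+ (m + k))%g e j = ~~ e k.
  have r_gt0 : (0 < r)%N by apply: leq_ltn_trans (ltn_ord i).
  have := H (r - i)%N i i; rewrite subnK; last exact: ltnW.
  by rewrite subnKC; [apply | exact: ltnW].
elim: m j => [|m IHm] j.
  by rewrite addn0 => def_r; have := ltn_ord j; rewrite def_r ltnn.
move=> def_r; rewrite addSn expgSr permM permE ffunE.
case: eqP => [jr|/eqP jr].
  have m0 : m = 0%N by apply: (@addnI j.+1); rewrite addn0 addSnnS def_r.
  rewrite m0 add0n (@flip_shift_iter _ _ _ _ k) //= jr modnn //.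
apply: IHm; have lt_jr : (j.+1 < r)%N by rewrite ltn_neqAle jr ltn_ord.
by rewrite /= modn_small // addSnnS.
Qed.

(* Orbits are stable under negation of all signs, so the division by 2 in
   [alternating_order] is exact. *)
Lemma alternating_orderE (r : nat) (e : signs r) :
  (0 < r)%N -> #|porbit (flip_shift r) e| = (alternating_order e * 2)%N.
Proof.
case: r e => // r e _; set s := flip_shift _; set O := porbit s e.
suff even_O : (2 %| #|O|)%N by rewrite /alternating_order divnK.
pose t := (s ^+ r.+1)%g.
have t_O y : (t y \in O) = (y \in O).
  by rewrite /O -!eq_porbit_mem /t porbit_perm.
pose A := [set y : signs r.+1 | y ord0].
have tA y : (t y \in A) = (y \notin A) by rewrite !inE flip_shift_iter_r.
have -> : #|O| = (#|O :&: A| * 2)%N.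
  rewrite muln2 -addnn -(cardsID A O); congr addn.
  rewrite -(card_imset (O :&: A) (@perm_inj _ t)); apply: eq_card => y.
  apply/idP/imsetP => [|[z] + ->]; last first.
    by rewrite in_setI in_setD tA t_O negbK andbC.
  rewrite in_setD => /andP[yA yO]; exists ((t^-1)%g y); last by rewrite permKV.
  by rewrite in_setI -t_O permKV yO -[_ \in A]negbK -tA permKV.
exact: dvdn_mull.
Qed.

(* When [F] is 'F_p, r = (p - 1) / 2 and [zeta] is a primitive 2r-th root of
   unity, the sample points are the nonzero squares and [f] maps each of them
   to one of its square roots, the one selected by [e]. *)
Definition is_sign_interpolant (F : fieldType) (r : nat) (zeta : F)
    (e : signs r) (f : {poly F}) : Prop :=
  (size f <= r)%N /\
  forall n : 'I_r, f.[zeta ^+ (2 * n)] = (-1) ^+ e n * zeta ^+ n.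

Lemma sign_interpolant_exists_unique (F : fieldType) (r : nat) (zeta : F)
    (e : signs r) :
  (2 * r).-primitive_root zeta -> exists! f, is_sign_interpolant zeta e f.
Proof.
move=> prim.
pose x (n : 'I_r) := zeta ^+ (2 * n).
have x_inj : injective x.
  move=> i j /eqP; rewrite (eq_prim_root_expr prim) !modn_small ?ltn_pmul2l //.
  by rewrite eqn_pmul2l // => /eqP/val_inj.
pose L i := \prod_(j < r | j != i) ((x i - x j)^-1 *: ('X - (x j)%:P)).
have LE i k : (L i).[x k] = (i == k)%:R.
  rewrite horner_prod; case: eqP => [<-|/eqP ik].
    rewrite big1 // => j ji; rewrite !hornerE mulVf // subr_eq0.
    by apply: contra_neq ji => /x_inj.
  by rewrite (bigD1 k) 1?eq_sym //= !hornerE subrr mulr0 mul0r.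
have size_L i : (size (L i) <= r)%N.
  have cardr : #|[pred j | j != i]|.+1 = r.
    by rewrite (cardC1 i) card_ord prednK // (leq_ltn_trans _ (ltn_ord i)).
  apply: leq_trans (size_poly_prod_leq _ _) _.
  apply: (@leq_trans ((\sum_(j < r | j != i) 2).+1 - #|[pred j | j != i]|)%N).
    rewrite leq_sub2r // ltnS; apply: leq_sum => j _.
    by rewrite (leq_trans (size_scale_leq _ _)) ?size_XsubC.
  by rewrite sum_nat_const muln2 -addnn -addSn addnK cardr.
exists (\sum_i ((-1) ^+ e i * zeta ^+ i) *: L i); split=> [|g [size_g gE]].
  split=> [|k].
    apply: leq_trans (size_sum _ _ _) _; apply/bigmax_leqP => i _.
    exact: leq_trans (size_scale_leq _ _) (size_L i).
  rewrite horner_sum (bigD1 k) //= hornerZ (LE k k) eqxx mulr1 big1 ?addr0 //.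
  by move=> i ik; rewrite hornerZ (LE i k) (negPf ik) mulr0.
apply/eqP; rewrite -subr_eq0; set h := _ - _.
apply/eqP; apply: (@roots_geq_poly_eq0 _ h [seq x i | i <- enum 'I_r]).
- apply/allP => _ /mapP[k _ ->].
  rewrite rootE !hornerE gE horner_sum (bigD1 k) //=.
  rewrite hornerZ (LE k k) eqxx mulr1 big1 ?addr0 ?subrr //.
  by move=> i ik; rewrite hornerZ (LE i k) (negPf ik) mulr0.
- by rewrite map_inj_uniq // enum_uniq.
rewrite size_map size_enum_ord (leq_trans (size_polyD _ _)) //.
rewrite size_polyN geq_max size_g andbT.
apply: leq_trans (size_sum _ _ _) _; apply/bigmax_leqP => i _.
exact: leq_trans (size_scale_leq _ _) (size_L i).
Qed.

(* Main.v *)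
Require Import Defs.
From mathcomp Require Import all_boot all_order all_fingroup all_algebra.
From mathcomp Require Import zify.

Set Implicit Arguments.
Unset Strict Implicit.
Unset Printing Implicit Defensive.

Import GRing.Theory.
Local Open Scope ring_scope.

(* If [r = d * D] with [D] odd, alternating order [d] forces the [d]-fold flip
   shift of [e] to be [- e], so [f (zeta ^ (2 d) * x) = - zeta ^ d * f x] for all
   [r]-th roots of unity [x], hence identically as [deg f < r]. Comparing leading
   coefficients and using [-1 = zeta ^ r], the degree [k] of [f] satisfies
   [zeta ^ (2 d k) = zeta ^ (d + r)], i.e. [k = (D + 1) / 2] modulo [D]. *)

Lemma prim_root_expr_half (F : fieldType) (r : nat) (zeta : F) :
  (0 < r)%N -> (2 * r).-primitive_root zeta -> zeta ^+ r = -1.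
Proof.
move=> r_gt0 prim.
have : (zeta ^+ r) ^+ 2 == 1 by rewrite -exprM mulnC prim_expr_order.
rewrite sqrf_eq1 => /orP[|/eqP //].
rewrite -[1](expr0 zeta) (eq_prim_root_expr prim) mod0n modn_small.
  by rewrite eqn0Ngt r_gt0.
by rewrite ltn_Pmull.
Qed.

Section AlternatingOrder.

Variables (r d D : nat) (e : signs r).
Hypotheses (r_eq : r = (d * D)%N) (oddD : odd D) (ord_e : alternating_order e = d).

Let s := flip_shift r.

(** The orbit of [e] has [d * 2] elements, so [s ^+ (d * 2)] fixes [e]; for [r = 0] there is only
    one sign vector. *)
Let shift_period k : (s ^+ (k * (d * 2)))%g e = e.
Proof.
case: (posnP r) => [r0|r_gt0].
  by apply/ffunP => i; have := ltn_ord i; rewrite {2}r0.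
rewrite -ord_e -alternating_orderE //.
by rewrite mulnC expgM permX_fix // permX iter_porbit.
Qed.

(** As [D] is odd, [r] is [d] plus a multiple of the period [d * 2]; hence [s ^+ d] acts on [e] like
    [s ^+ r], which negates every sign. *)
Lemma flip_shift_alternating_order (i : 'I_r) : (s ^+ d)%g e i = ~~ e i.
Proof.
rewrite -flip_shift_iter_r -/s; congr (fun_of_fin _ i).
have def_r : r = (D./2 * (d * 2) + d)%N.
  by rewrite r_eq -[in LHS](odd_double_half D) oddD; lia.
by rewrite [in RHS](congr1 (fun n => (s ^+ n)%g) def_r) expgD permM shift_period.
Qed.

(** This compares [e] at [d + i - r] and at [i] when the index [d + i] runs past the end. *)
Lemma flip_shift_alternating_compl : (s ^+ (r - d))%g e = e.
Proof.
have -> : (r - d = D./2 * (d * 2))%N.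
  by rewrite r_eq -[in LHS](odd_double_half D) oddD; lia.
exact: shift_period.
Qed.

End AlternatingOrder.

Section Interpolant.

Variables (F : fieldType) (r d D : nat) (zeta : F) (e : signs r) (f : {poly F}).
Hypotheses (r_gt0 : (0 < r)%N) (r_eq : r = (d * D)%N) (oddD : odd D).
Hypotheses (ord_e : alternating_order e = d).
Hypotheses (prim : (2 * r).-primitive_root zeta).
Hypothesis interp : is_sign_interpolant zeta e f.

Lemma sign_interpolant_horner_twist (i : 'I_r) :
  f.[zeta ^+ (2 * d) * zeta ^+ (2 * i)] = - zeta ^+ d * f.[zeta ^+ (2 * i)].
Proof.
have [_ fE] := interp; rewrite fE -exprD -mulnDr.
have D_gt0 : (0 < D)%N by case: (D) oddD.
have le_dr : (d <= r)%N by rewrite r_eq leq_pmulr.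
have [lt_r|le_r] := ltnP (d + i) r.
  rewrite (fE (Ordinal lt_r)) /= -(@flip_shift_iter _ _ d i) /=; last exact: addnC.
  rewrite (flip_shift_alternating_order r_eq oddD ord_e) signrN exprD.
  by rewrite !mulNr mulrCA.
(* Wrap-around: the sample point is the one of index [d + i - r]. The sign bit there is that of [i],
   and the minus sign now comes from [zeta ^+ r = -1]. *)
have lt_j : (d + i - r < r)%N by have := ltn_ord i; lia.
have zN := prim_root_expr_half r_gt0 prim.
have -> : (2 * (d + i) = 2 * (d + i - r) + 2 * r)%N by lia.
rewrite exprD (prim_expr_order prim) // mulr1 (fE (Ordinal lt_j)) /=.
have -> : e (Ordinal lt_j) = e i.
  rewrite -(@flip_shift_iter _ e (r - d) (Ordinal lt_j) i) /=; last by lia.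
  by rewrite (flip_shift_alternating_compl r_eq oddD ord_e).
have -> : zeta ^+ (d + i - r) = - zeta ^+ (d + i).
  by rewrite -[in RHS](subnK le_r) exprD zN mulrN1 opprK.
by rewrite exprD mulrN mulNr mulrCA.
Qed.

(** Both sides have size at most [r] and agree at the [r] distinct points [zeta ^+ (2 * i)]. *)
Lemma sign_interpolant_twist : f \Po (zeta ^+ (2 * d) *: 'X) = - zeta ^+ d *: f.
Proof.
have [size_f _] := interp.
apply/eqP; rewrite -subr_eq0; apply/eqP.
pose x (i : 'I_r) := zeta ^+ (2 * i).
apply: (@roots_geq_poly_eq0 _ _ [seq x i | i <- enum 'I_r]).
- apply/allP => _ /mapP[i _ ->].
  by rewrite rootE !hornerE horner_comp !hornerE sign_interpolant_horner_twist subrr.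
- rewrite map_inj_uniq ?enum_uniq // => i j /eqP.
  rewrite (eq_prim_root_expr prim) !modn_small ?ltn_pmul2l //.
  by rewrite eqn_pmul2l // => /eqP/val_inj.
rewrite size_map size_enum_ord (leq_trans (size_polyD _ _)) // size_polyN geq_max.
rewrite (leq_trans (size_scale_leq _ _)) // andbT.
(* Composition preserves the size only if the inner polynomial is really linear, so a zero scalar is
   treated apart. *)
have [z0|z_neq0] := eqVneq (zeta ^+ (2 * d)) 0.
  rewrite z0 scale0r comp_poly0r (leq_trans (size_polyC_leq1 _)) //.
by rewrite size_comp_poly2 // size_scale // size_polyX.
Qed.

(** At the sample point [zeta ^+ 0 = 1] the value is a sign. *)
Lemma sign_interpolant_neq0 : f != 0.
Proof.
have [_ fE] := interp; apply: contraTneq isT => f0.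
move: (fE (Ordinal r_gt0)); rewrite f0 horner0 expr0 mulr1 => /esym/eqP.
by rewrite signr_eq0.
Qed.

Lemma sign_interpolant_degree : (D %| (size f).-1 + D./2)%N.
Proof.
have D_gt0 : (0 < D)%N by case: (D) oddD.
have d_gt0 : (0 < d)%N by move: r_gt0; rewrite r_eq muln_gt0 => /andP[].
have zeta_neq0 : zeta != 0 by rewrite (prim_root_eq0 prim) -lt0n muln_gt0.
have q_neq0 : zeta ^+ (2 * d) != 0 by rewrite expf_neq0.
have := congr1 lead_coef sign_interpolant_twist.
rewrite lead_coef_comp ?size_scale ?size_polyX //.
rewrite !lead_coefZ lead_coefX mulr1 mulrC => /mulIf.
rewrite lead_coef_eq0 sign_interpolant_neq0 => /(_ isT)/eqP.
rewrite -mulrN1 -(prim_root_expr_half r_gt0 prim) -exprM -exprD.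
rewrite (eq_prim_root_expr prim) r_eq mulnA.
have -> : (d + d * D = 2 * d * D./2.+1)%N.
  by rewrite -[in LHS](odd_double_half D) oddD; lia.
(* Cancelling [2 * d] from the exponents and from the modulus [2 * d * D] leaves a congruence modulo
   [D]; adding [D./2] turns its right side into [D]. *)
rewrite -!muln_modr eqn_pmul2l ?muln_gt0 // -(eqn_modDr D./2) => /eqP.
have -> : (D./2.+1 + D./2)%N = D by rewrite addSn addnn -[RHS](odd_double_half D) oddD.
by rewrite modnn => /eqP.
Qed.

End Interpolant.

Theorem proposition6p1 (p r d D : nat) (zeta : 'F_p) (e : signs r)
    (f : {poly 'F_p}) :
  prime p -> odd p -> r = ((p - 1) %/ 2)%N ->
  (0 < d)%N -> (d %| r)%N -> D = (r %/ d)%N -> odd D ->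
  (2 * r).-primitive_root zeta ->
  is_sign_interpolant zeta e f ->
  alternating_order e = d ->
  exists n : nat,
    ((size f).-1)%:Z = r%:Z - ((D - 1) %/ 2)%N%:Z - n%:Z * D%:Z.
Proof.
move=> _ _ _ d_gt0 dvd_dr def_D oddD prim interp ord_e.
have r_eq : r = (d * D)%N by rewrite def_D mulnC divnK.
have D_gt0 : (0 < D)%N by case: (D) oddD.
have r_gt0 : (0 < r)%N by rewrite r_eq muln_gt0 d_gt0.
have /dvdnP[q def_q] := sign_interpolant_degree r_gt0 r_eq oddD ord_e prim interp.
(* [q * D] is the degree plus [D./2], hence less than [r + D = d.+1 * D]. *)
have le_qd : (q <= d)%N.
  rewrite -ltnS -(ltn_pmul2r D_gt0) -def_q mulSn -r_eq.
  by have [size_f _] := interp; lia.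
have -> : ((D - 1) %/ 2 = D./2)%N by lia.
(* The degree is [q * D - D./2], and [q * D = r - (d - q) * D]. *)
exists (d - q)%N.
have : ((d - q) * D + q * D = d * D)%N by rewrite -mulnDl subnK.
rewrite -r_eq -def_q -PoszM; move: ((d - q) * D)%N (size f).-1 D./2 => m k h; lia.
Qed.
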